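(* Let $M$ be a three-dimensional contact sub-Riemannian structure. If $\zeta_1,\zeta_2:I\to M$ are two smooth horizontal curves parametrized by arc length such that (i) $\zeta_1(0)=\zeta_2(0)$ and $\dot\zeta_1(0)=\dot\zeta_2(0)$, (ii) $h_{\zeta_1}(t)=h_{\zeta_2}(t)$ for every $t\in I$, where $h_{\zeta_i}$ is the characteristic deviation of $\zeta_i$, then $\zeta_1(t)=\zeta_2(t)$ for every $t\in I$.
   Context: $I$ denotes an open interval containing $0$. A three-dimensional contact sub-Riemannian structure is a smooth 3-manifold $M$ with a contact form $\omega$ (a smooth $1$-form with $\omega\wedge d\omega\neq 0$), the distribution $\Delta=\ker\omega$, and a smooth metric $g$ on $\Delta$ with norm $\|\cdot\|$. The form $\omega$ is normalized so that $d\omega|_\Delta=-\mathrm{vol}_\Delta$, with $\mathrm{vol}_\Delta$ the area form of $g$ on $\Delta$; here $d\omega(X,Y)=X\omega(Y)-Y\omega(X)-\omega([X,Y])$. A smooth curve is horizontal if its velocity lies in $\Delta$. The Reeb vector field $X_0$ is defined by $\omega(X_0)=1$, $d\omega(X_0,\cdot)=0$. The metric $g$ is extended to a Riemannian metric on $M$ so that $X_0$ has norm one and is orthogonal to $\Delta$. $J:\Delta\to\Delta$ is the linear endomorphism with $g(X,JY)=d\omega(X,Y)$ for horizontal $X,Y$, extended by $JX_0=0$. The Tanno connection $\nabla$ is the unique linear connection on $M$ such that, with $T$ its torsion, $T(X,Y)=\nabla_XY-\nabla_YX-[X,Y]$: (i) $\nabla\omega=0$; (ii) $\nabla X_0=0$;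 (iii) $\nabla g=0$; (iv) $T(X,Y)=d\omega(X,Y)X_0$ for horizontal $X,Y$; (v) $T(X_0,JX)=-JT(X_0,X)$ for every vector field $X$. The characteristic deviation of a smooth horizontal curve $\zeta:I\to M$ parametrized by arc length is the function $h_\zeta:I\to\mathbb{R}$, $h_\zeta=g(\nabla_{\dot\zeta}\dot\zeta,J\dot\zeta)$. *)

(* Defs.v *)
From HB Require Import structures.
From mathcomp Require Import all_boot all_order all_algebra.
From mathcomp Require Import all_classical all_reals.
From mathcomp Require Import topology normedtype derive.

Set Implicit Arguments.
Unset Strict Implicit.
Unset Printing Implicit Defensive.

Import Order.TTheory GRing.Theory Num.Theory.
Import numFieldNormedType.Exports.

Local Open Scope classical_set_scope.
Local Open Scope ring_scope.

(* Functions are total; only their values on the open set U matter.  For V of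
   finite dimension this is the usual notion of a C^k map on U. *)
Fixpoint Ck_on (R : realType) (V W : normedModType R) (k : nat)
    (U : set V) (f : V -> W) : Prop :=
  match k with
  | 0 => forall x, U x -> {for x, continuous f}
  | k'.+1 => (forall x, U x -> differentiable f x) /\
             (forall v : V, Ck_on k' U (fun x => 'D_v f x))
  end.

Definition smooth_on (R : realType) (V W : normedModType R)
    (U : set V) (f : V -> W) : Prop := forall k, Ck_on k U f.

Record chart (R : realType) (T : topologicalType) := Chart {
  dom : set T;
  img : set 'rV[R]_3;
  coord : T -> 'rV[R]_3;
  param : 'rV[R]_3 -> T;
  dom_open : open dom;
  img_open : open img;
  coord_img : forall p, dom p -> img (coord p);
  param_dom : forall x, img x -> dom (param x);
  coordK : forall p, dom p -> param (coord p) = p;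
  paramK : forall x, img x -> coord (param x) = x;
  coord_continuous : forall p, dom p -> {for p, continuous coord};
  param_continuous : forall x, img x -> {for x, continuous param} }.

(* Where the transition map is defined, in the coordinates of c. *)
Definition overlap (R : realType) (T : topologicalType) (c d : chart R T) :
    set 'rV[R]_3 := [set x | img c x /\ dom d (param c x)].

Definition transition (R : realType) (T : topologicalType) (c d : chart R T) :
    'rV[R]_3 -> 'rV[R]_3 := fun x => coord d (param c x).

(* The atlas need not be maximal.  chart_at selects one chart around each
   point; it serves to write tangent vectors at p as elements of R^3. *)
Record manifold3 (R : realType) := Manifold3 {
  space :> topologicalType;
  space_hausdorff : hausdorff_space space;
  space_second_countable : @second_countable space;
  atlas : Type;
  chart_of : atlas -> chart R space;
  chart_at : space -> atlas;
  chart_at_dom : forall p, dom (chart_of (chart_at p)) p;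
  transition_smooth : forall c d : atlas,
    smooth_on (overlap (chart_of c) (chart_of d))
              (transition (chart_of c) (chart_of d)) }.

Coercion chart_of : atlas >-> chart.

(* Tensor fields are given by their local expressions in the charts of the
   atlas, subject to the transformation law under changes of coordinates; the
   Jacobian of the transition map t at x sends u to 'D_u t x. *)

Record vector_field (R : realType) (M : manifold3 R) := VectorField {
  vf :> atlas M -> 'rV[R]_3 -> 'rV[R]_3;
  vf_smooth : forall c : atlas M, smooth_on (img c) (vf c);
  vf_change : forall (c d : atlas M) x, overlap c d x ->
    vf d (transition c d x) = 'D_(vf c x) (transition c d) x }.

Record one_form (R : realType) (M : manifold3 R) := OneForm {
  form :> atlas M -> 'rV[R]_3 -> 'rV[R]_3 -> R;
  form_linear : forall (c : atlas M) x (a : R) u v, img c x ->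
    form c x (a *: u + v) = a * form c x u + form c x v;
  form_smooth : forall (c : atlas M) v, smooth_on (img c) (fun x => form c x v);
  form_change : forall (c d : atlas M) x u, overlap c d x ->
    form d (transition c d x) ('D_u (transition c d) x) = form c x u }.

Record endo_field (R : realType) (M : manifold3 R) := EndoField {
  endo :> atlas M -> 'rV[R]_3 -> 'rV[R]_3 -> 'rV[R]_3;
  endo_linear : forall (c : atlas M) x (a : R) u v, img c x ->
    endo c x (a *: u + v) = a *: endo c x u + endo c x v;
  endo_smooth : forall (c : atlas M) v, smooth_on (img c) (fun x => endo c x v);
  endo_change : forall (c d : atlas M) x u, overlap c d x ->
    endo d (transition c d x) ('D_u (transition c d) x) =
    'D_(endo c x u) (transition c d) x }.

(* A linear connection, given by its Christoffel symbols: christoffel c x u v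
   has k-th coordinate sum_(i, j) Gamma^k_ij(x) u_i v_j.  The last field is
   their (inhomogeneous) transformation law; it says that the operator
   cov_deriv below, (X, Y) |-> nabla_X Y, commutes with changes of charts. *)
Record connection (R : realType) (M : manifold3 R) := Connection {
  christoffel : atlas M -> 'rV[R]_3 -> 'rV[R]_3 -> 'rV[R]_3 -> 'rV[R]_3;
  christoffel_linearl : forall (c : atlas M) x (a : R) u u' v, img c x ->
    christoffel c x (a *: u + u') v =
    a *: christoffel c x u v + christoffel c x u' v;
  christoffel_linearr : forall (c : atlas M) x (a : R) u v v', img c x ->
    christoffel c x u (a *: v + v') =
    a *: christoffel c x u v + christoffel c x u v';
  christoffel_smooth : forall (c : atlas M) u v,
    smooth_on (img c) (fun x => christoffel c x u v);
  christoffel_change : forall (c d : atlas M) x u v, overlap c d x ->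
    'D_u (fun y => 'D_v (transition c d) y) x
    + christoffel d (transition c d x)
        ('D_u (transition c d) x) ('D_v (transition c d) x) =
    'D_(christoffel c x u v) (transition c d) x }.

Section LocalCalculus.
Context {R : realType}.
Implicit Types (X Y : 'rV[R]_3 -> 'rV[R]_3).
Implicit Types (w : 'rV[R]_3 -> 'rV[R]_3 -> R) (x : 'rV[R]_3).

Definition lie_bracket X Y x : 'rV[R]_3 := 'D_(X x) Y x - 'D_(Y x) X x.

Definition ext_deriv w X Y x : R :=
  'D_(X x) (fun y => w y (Y y)) x - 'D_(Y x) (fun y => w y (X y)) x
  - w x (lie_bracket X Y x).

(* The value on two tangent vectors; ext_deriv is tensorial, so that it can be
   computed on the extensions with constant coordinates. *)
Definition ext_deriv_at w x (u v : 'rV[R]_3) : R :=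
  ext_deriv w (fun=> u) (fun=> v) x.

Definition wedge_ext_deriv w x (u1 u2 u3 : 'rV[R]_3) : R :=
  w x u1 * ext_deriv_at w x u2 u3 + w x u2 * ext_deriv_at w x u3 u1
  + w x u3 * ext_deriv_at w x u1 u2.

Definition cov_deriv (M : manifold3 R) (nabla : connection M) (c : atlas M)
    X Y x : 'rV[R]_3 := 'D_(X x) Y x + christoffel nabla c x (X x) (Y x).

Definition torsion (M : manifold3 R) (nabla : connection M) (c : atlas M)
    X Y x : 'rV[R]_3 :=
  cov_deriv nabla c X Y x - cov_deriv nabla c Y X x - lie_bracket X Y x.

(* vol is one of the two area forms, opposite to each other, of the inner
   product g on the plane D. *)
Definition is_area_form (D : set 'rV[R]_3)
    (g vol : 'rV[R]_3 -> 'rV[R]_3 -> R) : Prop :=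
  [/\ forall (a : R) u u' v, D u -> D u' -> D v ->
        vol (a *: u + u') v = a * vol u v + vol u' v,
      forall u v, D u -> D v -> vol v u = - vol u v
    & forall u v, D u -> D v -> g u u = 1 -> g v v = 1 -> g u v = 0 ->
        `|vol u v| = 1].

End LocalCalculus.

(* The distribution ker w, in the coordinates of a chart. *)
Definition ker_form (R : realType) (M : manifold3 R) (w : one_form M)
    (c : atlas M) (x : 'rV[R]_3) : set 'rV[R]_3 := [set u | w c x u = 0].

Definition local_vf (R : realType) (M : manifold3 R) (c : atlas M)
    (X : 'rV[R]_3 -> 'rV[R]_3) : Prop := smooth_on (img c) X.

Definition local_horizontal_vf (R : realType) (M : manifold3 R)
    (w : one_form M) (c : atlas M) (X : 'rV[R]_3 -> 'rV[R]_3) : Prop :=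
  local_vf c X /\ forall x, img c x -> ker_form w c x (X x).

(* A metric on the distribution ker w: its values outside of ker w are
   irrelevant. *)
Record sub_metric (R : realType) (M : manifold3 R) (w : one_form M) :=
    SubMetric {
  metric :> atlas M -> 'rV[R]_3 -> 'rV[R]_3 -> 'rV[R]_3 -> R;
  metric_linear : forall (c : atlas M) x (a : R) u u' v, img c x ->
    ker_form w c x u -> ker_form w c x u' -> ker_form w c x v ->
    metric c x (a *: u + u') v = a * metric c x u v + metric c x u' v;
  metric_sym : forall (c : atlas M) x u v, img c x ->
    ker_form w c x u -> ker_form w c x v -> metric c x u v = metric c x v u;
  metric_pos : forall (c : atlas M) x u, img c x ->
    ker_form w c x u -> u != 0 -> 0 < metric c x u u;
  metric_smooth : forall (c : atlas M) X Y,
    local_horizontal_vf w c X -> local_horizontal_vf w c Y ->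
    smooth_on (img c) (fun x => metric c x (X x) (Y x));
  metric_change : forall (c d : atlas M) x u v, overlap c d x ->
    ker_form w c x u -> ker_form w c x v ->
    metric d (transition c d x)
      ('D_u (transition c d) x) ('D_v (transition c d) x) = metric c x u v }.

(* The normalization determines csr_vol, and with it the orientation of the
   distribution; in particular csr_vol is automatically smooth and compatible
   with changes of charts. *)
Record contact_subriemannian3 (R : realType) := ContactSubRiemannian3 {
  csr_manifold :> manifold3 R;
  csr_form : one_form csr_manifold;
  csr_contact : forall (c : atlas csr_manifold) x, img c x ->
    exists u1 u2 u3, wedge_ext_deriv (csr_form c) x u1 u2 u3 != 0;
  csr_metric : sub_metric csr_form;
  csr_vol : atlas csr_manifold -> 'rV[R]_3 -> 'rV[R]_3 -> 'rV[R]_3 -> R;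
  csr_vol_area : forall (c : atlas csr_manifold) x, img c x ->
    is_area_form (ker_form csr_form c x) (csr_metric c x) (csr_vol c x);
  csr_normalized : forall (c : atlas csr_manifold) x u v, img c x ->
    ker_form csr_form c x u -> ker_form csr_form c x v ->
    ext_deriv_at (csr_form c) x u v = - csr_vol c x u v }.

Section ContactGeometry.
Context {R : realType} (S : contact_subriemannian3 R).

Local Notation w := (csr_form S).
Local Notation g := (csr_metric S).

Definition is_reeb (X0 : vector_field S) : Prop :=
  forall (c : atlas S) x, img c x ->
    w c x (X0 c x) = 1 /\ forall u, ext_deriv_at (w c) x (X0 c x) u = 0.

(* The extension of g for which X0 has norm one and is orthogonal to ker w;
   u - w u *: X0 is the component of u in ker w. *)
Definition ext_metric (X0 : vector_field S) (c : atlas S)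
    (x u v : 'rV[R]_3) : R :=
  g c x (u - w c x u *: X0 c x) (v - w c x v *: X0 c x) + w c x u * w c x v.

Definition is_contact_endo (X0 : vector_field S) (J : endo_field S) : Prop :=
  forall (c : atlas S) x, img c x ->
  [/\ forall u, ker_form w c x u -> ker_form w c x (J c x u),
      forall u v, ker_form w c x u -> ker_form w c x v ->
        g c x u (J c x v) = ext_deriv_at (w c) x u v
    & J c x (X0 c x) = 0].

Definition is_tanno_connection (X0 : vector_field S) (J : endo_field S)
    (nabla : connection S) : Prop :=
  forall c : atlas S,
  let T := torsion nabla c in
  let Jf (X : 'rV[R]_3 -> 'rV[R]_3) := fun y => J c y (X y) in
  [/\ forall X Y, local_vf c X -> local_vf c Y -> forall x, img c x ->
        'D_(X x) (fun y => w c y (Y y)) x - w c x (cov_deriv nabla c X Y x) = 0,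
      forall X, local_vf c X -> forall x, img c x ->
        cov_deriv nabla c X (X0 c) x = 0,
      forall X Y Z, local_vf c X -> local_vf c Y -> local_vf c Z ->
        forall x, img c x ->
        'D_(X x) (fun y => ext_metric X0 c y (Y y) (Z y)) x
        - ext_metric X0 c x (cov_deriv nabla c X Y x) (Z x)
        - ext_metric X0 c x (Y x) (cov_deriv nabla c X Z x) = 0,
      forall X Y, local_horizontal_vf w c X -> local_horizontal_vf w c Y ->
        forall x, img c x -> T X Y x = ext_deriv (w c) X Y x *: X0 c x
    & forall X, local_vf c X -> forall x, img c x ->
        T (X0 c) (Jf X) x = - J c x (T (X0 c) X x)].

Section Curves.
Variables (I : set R) (zeta : R -> S).

Definition smooth_curve : Prop :=
  (forall t, I t -> {for t, continuous zeta}) /\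
  forall c : atlas S,
    smooth_on (I `&` zeta @^-1` dom c) (fun t => coord c (zeta t)).

(* The curve in the coordinates of the chart selected at zeta t: meaningful for
   s near t only.  Since equal points select the same chart, velocities of
   different curves at a common point can be compared as elements of R^3. *)
Definition local_curve (t : R) : R -> 'rV[R]_3 :=
  fun s => coord (chart_at (zeta t)) (zeta s).

Definition velocity (t : R) : 'rV[R]_3 := derive1 (local_curve t) t.

(* nabla_(zeta') zeta' at time t. *)
Definition cov_acceleration (nabla : connection S) (t : R) : 'rV[R]_3 :=
  derive1 (derive1 (local_curve t)) t
  + christoffel nabla (chart_at (zeta t)) (local_curve t t)
      (velocity t) (velocity t).

Definition horizontal : Prop :=
  forall t, I t ->
    ker_form w (chart_at (zeta t)) (local_curve t t) (velocity t).

Definition arc_length_param : Prop :=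
  forall t, I t ->
    Num.sqrt (g (chart_at (zeta t)) (local_curve t t)
                (velocity t) (velocity t)) = 1.

Definition char_deviation (X0 : vector_field S) (J : endo_field S)
    (nabla : connection S) (t : R) : R :=
  let c := chart_at (zeta t) in
  let x := local_curve t t in
  ext_metric X0 c x (cov_acceleration nabla t) (J c x (velocity t)).

End Curves.

End ContactGeometry.

(* Main.v *)
Require Import Defs.
From HB Require Import structures.
From mathcomp Require Import all_boot all_order all_algebra.
From mathcomp Require Import all_classical all_reals.
From mathcomp Require Import topology normedtype landau derive.
From mathcomp Require Import ring lra.

Import Order.TTheory GRing.Theory Num.Theory.
Import numFieldNormedType.Exports.

Local Open Scope classical_set_scope.
Local Open Scope ring_scope.
Set Implicit Arguments.
Unset Strict Implicit.
Unset Printing Implicit Defensive.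

(** In a chart, let x be the coordinates of a horizontal curve of unit speed and
    a = x'' + Gamma(x)(x', x') its covariant acceleration.  The connection preserves
    the contact form and the extended metric, so differentiating w(x') = 0 and
    g(x', x') = 1 shows that a is horizontal and orthogonal to x'.  The distribution
    has rank two and J x' spans the orthogonal of x' in it, so a is determined by
    its component along J x', which is the characteristic deviation h.  Hence
      x'' = h(t) J(x) x' - Gamma(x)(x', x')
    (lemma curve_equation): the curve solves a second order equation that depends
    on h only.

    The coefficients J and Gamma are smooth and h is continuous, so two solutions
    with the same position and velocity at t0 agree near t0 (near_curve_eq).  This
    rests on two estimates.  The right-hand sides along the two solutions differ by
    at most a multiple of the distance between the solutions in phase space
    (lipschitz_pair), and a function that vanishes at t0 and whose derivative is
    bounded by a multiple of its size vanishes near t0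
    (linear_differential_inequality).

    The set of times near which the two curves agree is open and contains 0.  At a
    point of its closure in I the positions agree because the manifold is
    Hausdorff, and the velocities agree by continuity, so local uniqueness applies
    again: the set is closed in I, and I is connected. *)

(** * Differential calculus along curves *)

Section Calculus.
Context {R : realType}.
Implicit Types V W : normedModType R.

Lemma is_diff_scale V W (k : V -> R) (f : V -> W) x :
  differentiable k x -> differentiable f x ->
  is_diff x (fun y => k y *: f y) (fun h => k x *: 'd f x h + 'd k x h *: f x).
Proof.
move=> dk df.
pose sc : R -> W -> W := fun a u => a *: u.
have sc_bil : bilinear_for (GRing.Scale.Law.clone _ _ *:%R _)
    (GRing.Scale.Law.clone _ _ *:%R _) sc.
  by split => [u a b c|u a b c]; rewrite /sc /= ?scalerDl ?scalerDr !scalerA// mulrC.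
pose bM := bilinear_isBilinear.Build R R W W _ _ sc sc_bil.
pose bL : {bilinear R -> W -> W} := HB.pack sc bM.
have sc_cont : continuous (fun p => bL p.1 p.2).
  by move=> p; exact: scale_continuous.
have -> : (fun y => k y *: f y) = (fun p => bL p.1 p.2) \o (fun y => (k y, f y)) by [].
have dp : differentiable (fun y => (k y, f y)) x by exact: differentiable_pair.
have db : differentiable (fun p : R * W => bL p.1 p.2) (k x, f x).
  exact: differentiable_bilin.
apply: DiffDef; first exact: differentiable_comp.
by rewrite diff_comp// diff_bilin// diff_pair.
Qed.

Lemma near_eq_differentiable V W (f g : V -> W) x :
  (\forall y \near x, f y = g y) -> differentiable f x -> differentiable g x.
Proof.
move=> fg /diff_locallyP[cf ef].
have eg : g \o shift x = cst (g x) + 'd f x +o_ (nbhs 0) id.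
  apply/eqaddoP => e e0.
  have /eqaddoP/(_ e e0) := ef.
  have fg0 : \forall y \near 0, f (y + x) = g (y + x).
    by move: fg; rewrite (near_shift 0) /= subr0.
  apply: filterS2 fg0 => y fgy.
  by rewrite ![(_ - _) _]/(_ - _) !fctE /= fgy -(nbhs_singleton fg).
have dfg : 'd g x = 'd f x :> (V -> W) by exact: diff_unique.
by apply/diff_locallyP; rewrite dfg.
Qed.

Lemma differentiable_scale V W (k : V -> R) (f : V -> W) x :
  differentiable k x -> differentiable f x -> differentiable (fun y => k y *: f y) x.
Proof. by move=> dk df; have [] := is_diff_scale dk df. Qed.

Lemma derive_scale V W (k : V -> R) (f : V -> W) x v :
  differentiable k x -> differentiable f x ->
  'D_v (fun y => k y *: f y) x = k x *: 'D_v f x + 'D_v k x *: f x.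
Proof.
move=> dk df; have [dkf e] := is_diff_scale dk df.
by rewrite (deriveE _ dkf) (deriveE _ dk) (deriveE _ df) e.
Qed.

Lemma derive_curve W V (f : V -> W) (c : R -> V) t :
  differentiable c t -> differentiable f (c t) ->
  'D_1 (f \o c) t = 'D_('D_1 c t) f (c t).
Proof.
move=> dc df.
by rewrite (deriveE _ df) (deriveE _ dc) (deriveE _ (differentiable_comp dc df)) diff_comp.
Qed.

Lemma differentiable_entry V n (f : V -> 'rV[R]_n) x :
  differentiable f x -> forall i, differentiable (fun y => f y 0 i) x.
Proof.
move=> df i.
have := differentiable_comp df (differentiable_coord (f x) 0 i).
by apply.
Qed.

Lemma derive_entry V n (f : V -> 'rV[R]_n) x v :
  differentiable f x -> forall i, 'D_v (fun y => f y 0 i) x = 'D_v f x 0 i.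
Proof.
move=> df i.
by rewrite derive_mx ?mxE//; exact: diff_derivable.
Qed.

Lemma linear_rV_sum W n (L : 'rV[R]_n -> W) :
  (forall a u v, L (a *: u + v) = a *: L u + L v) ->
  forall u, L u = \sum_(i < n) u 0 i *: L (delta_mx 0 i).
Proof.
move=> linL u.
have L0 : L 0 = 0.
  have := linL (-1) 0 0.
  by rewrite scaleN1r oppr0 addr0 scaleN1r addNr.
rewrite {1}(row_sum_delta u).
elim/big_rec2: _ => // i y1 y2 _ <-.
by rewrite linL.
Qed.

Lemma derive_linear V W (f : V -> W) x : differentiable f x ->
  forall a u v, 'D_(a *: u + v) f x = a *: 'D_u f x + 'D_v f x.
Proof. by move=> df a u v; rewrite !(deriveE _ df) linearP. Qed.

Lemma derive_dirD V W (f : V -> W) x u v : differentiable f x ->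
  'D_(u + v) f x = 'D_u f x + 'D_v f x.
Proof. by move=> df; rewrite !(deriveE _ df) linearD. Qed.

Lemma differentiable_bigsum V W n (F : 'I_n -> V -> W) x :
  (forall i, differentiable (F i) x) ->
  differentiable (fun y => \sum_(i < n) F i y) x.
Proof.
move=> dF; have := differentiable_sum dF.
rewrite (_ : \sum_(i < n) F i = fun y => \sum_(i < n) F i y)//.
by apply/funext => y; rewrite fct_sumE.
Qed.

Lemma derive_bigsum V W n (F : 'I_n -> V -> W) x v :
  (forall i, differentiable (F i) x) ->
  'D_v (fun y => \sum_(i < n) F i y) x = \sum_(i < n) 'D_v (F i) x.
Proof.
move=> dF; rewrite -derive_sum; last by move=> i; exact: diff_derivable.
by congr ('D_v _ x); apply/funext=> y; rewrite fct_sumE.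
Qed.

Lemma linear_family_differentiable V W n (L : V -> 'rV[R]_n -> W) (u : V -> 'rV[R]_n) x :
  (\forall y \near x, forall a v w, L y (a *: v + w) = a *: L y v + L y w) ->
  (forall v, differentiable (L ^~ v) x) -> differentiable u x ->
  differentiable (fun y => L y (u y)) x.
Proof.
move=> linL dL du.
apply: (@near_eq_differentiable _ _
  (fun y => \sum_(i < n) u y 0 i *: L y (delta_mx 0 i))).
  by apply: filterS linL => y linLy; rewrite -linear_rV_sum.
apply: differentiable_bigsum => i; apply: differentiable_scale => //.
exact: differentiable_entry.
Qed.

(** Product rule for a matrix of functions applied to a vector of functions: on
    the basis expansion of u the two terms come from differentiating the
    coefficients of L and the entries of u.  Forms, endomorphisms, Christoffel
    symbols and differentials of transition maps along a curve are all handled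
    by it, once per linear argument. *)
Lemma derive_linear_family V W n (L : V -> 'rV[R]_n -> W) (u : V -> 'rV[R]_n) x d :
  (\forall y \near x, forall a v w, L y (a *: v + w) = a *: L y v + L y w) ->
  (forall v, differentiable (L ^~ v) x) -> differentiable u x ->
  'D_d (fun y => L y (u y)) x = 'D_d (L ^~ (u x)) x + L x ('D_d u x).
Proof.
move=> linL dL du.
have dui i := differentiable_entry du i.
have eL (w : V -> 'rV[R]_n) : 'D_d (fun y => L y (w y)) x
    = 'D_d (fun y => \sum_(i < n) w y 0 i *: L y (delta_mx 0 i)) x.
  apply: near_eq_derive.
  by apply: filterS linL => y linLy; rewrite -linear_rV_sum.
rewrite (eL u) (eL (fun=> u x)) (linear_rV_sum (nbhs_singleton linL)).
rewrite !derive_bigsum; last first.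
- by move=> i; exact: differentiable_scale.
- by move=> i; exact: differentiable_scale.
rewrite -big_split /=; apply: eq_bigr => i _.
rewrite !derive_scale// derive_cst scale0r addr0.
by rewrite derive_entry.
Qed.

End Calculus.

(** * Estimates for differential inequalities *)

Section Estimates.
Context {R : realType}.
Implicit Types V W : normedModType R.

Lemma rV_norm_le n (x : 'rV[R]_n) K : 0 <= K ->
  (forall i, `|x 0 i| <= K) -> `|x| <= K.
Proof.
move=> K0 xK; rewrite /Num.Def.normr/= mx_normrE.
by apply: bigmax_le => // -[i j] _ /=; rewrite (ord1 i).
Qed.

Lemma rV_norm_entry n (x : 'rV[R]_n) i : `|x 0 i| <= `|x|.
Proof.
rewrite [leRHS]/Num.Def.normr/= mx_normrE.
exact: (le_bigmax _ (fun ij => `|x ij.1 ij.2|) (0, i)).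
Qed.

(** The norm of 'rV_n is the maximum norm, so the scalar mean value theorem can be
    applied to each entry separately. *)
Lemma mean_value_rV n (u : R -> 'rV[R]_n) a b K : a <= b ->
  (forall t, a <= t <= b -> differentiable u t /\ `|'D_1 u t| <= K) ->
  `|u b - u a| <= K * (b - a).
Proof.
move=> ab uK.
have K0 : 0 <= K.
  have /uK[_] : a <= a <= b by rewrite lexx.
  exact: le_trans.
apply: rV_norm_le => [|i]; first by rewrite mulr_ge0// subr_ge0.
have dui t : a <= t <= b -> is_derive t 1 (fun s => u s 0 i) ('D_1 u t 0 i).
  move=> /uK[dut _]; apply: DeriveDef; last exact: derive_entry.
  exact/diff_derivable/differentiable_entry.
have [||c cab] := @MVT_segment R (fun t => u t 0 i) (fun t => 'D_1 u t 0 i) a b ab.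
- by move=> t; rewrite in_itv /= => /andP[at_ tb]; apply: dui; rewrite !ltW.
- apply: derivable_within_continuous => t; rewrite in_itv/= => /dui d.
  exact: ex_derive.
rewrite !mxE => ->; rewrite normrM (ger0_norm (_ : 0 <= b - a)) ?subr_ge0//.
apply: ler_wpM2r; first by rewrite subr_ge0.
apply: le_trans (rV_norm_entry _ _) _.
by have [] := uK c cab.
Qed.

Lemma mean_value_rV_dist n (u : R -> 'rV[R]_n) t0 t d K : `|t - t0| <= d ->
  (forall s, `|s - t0| <= d -> differentiable u s /\ `|'D_1 u s| <= K) ->
  `|u t - u t0| <= K * d.
Proof.
move=> td uK.
have d0 : 0 <= d by exact: le_trans td.
have K0 : 0 <= K.
  by have [|_] := uK t0; [rewrite subrr normr0|exact: le_trans].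
have [tt0|tt0] := leP t0 t.
- apply: (@le_trans _ _ (K * (t - t0))).
    apply: mean_value_rV => // s /andP[s1 s2]; apply: uK.
    move: td; rewrite !ger0_norm ?subr_ge0//; lra.
  by apply: ler_wpM2l => //; move: td; rewrite ger0_norm ?subr_ge0.
- rewrite distrC; apply: (@le_trans _ _ (K * (t0 - t))).
    apply: mean_value_rV; first exact: ltW.
    move=> s /andP[s1 s2]; apply: uK.
    move: td; rewrite !ler0_norm ?subr_le0//; try lra; exact: ltW.
  by apply: ler_wpM2l => //; move: td; rewrite ler0_norm ?subr_le0 ?opprB // ltW.
Qed.

(** A substitute for Gronwall's inequality without exponentials: if M is the
    maximum of |u| + |v| on a segment of radius d around t0, the mean value
    inequality gives M <= 2 * C * d * M, so that M = 0 once 2 * C * d < 1. *)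
Lemma linear_differential_inequality n (u v : R -> 'rV[R]_n) t0 C : 0 <= C ->
  (\forall t \near t0, [/\ differentiable u t, differentiable v t,
     `|'D_1 u t| <= C * (`|u t| + `|v t|) & `|'D_1 v t| <= C * (`|u t| + `|v t|)]) ->
  u t0 = 0 -> v t0 = 0 -> \forall t \near t0, u t = 0 /\ v t = 0.
Proof.
move=> C0 /nbhs_ballP[e /= e0 He] u0 v0.
pose d := Num.min (e / 2) ((4 * (C + 1))^-1).
have C40 : 0 < 4 * (C + 1) by lra.
have d0 : 0 < d by rewrite lt_min invr_gt0 C40 divr_gt0.
have de : d < e by rewrite /d gt_min; apply/orP; left; lra.
have Cd : 2 * C * d < 1.
  have dC : d <= (4 * (C + 1))^-1 by rewrite /d ge_min lexx orbT.
  have : d * (4 * (C + 1)) <= 1.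
    by rewrite -ler_pdivlMr // div1r.
  nra.
have Hd t : `|t - t0| <= d -> [/\ differentiable u t, differentiable v t,
     `|'D_1 u t| <= C * (`|u t| + `|v t|) & `|'D_1 v t| <= C * (`|u t| + `|v t|)].
  by move=> td; apply: He; rewrite /ball/= distrC; exact: le_lt_trans de.
have dE t : (t \in `[t0 - d, t0 + d]) = (`|t - t0| <= d).
  by rewrite in_itv /= ler_norml; apply/idP/idP => /andP[? ?]; apply/andP; split; lra.
pose m t := `|u t| + `|v t|.
have [||tm tmin mmax] := @EVT_max R m (t0 - d) (t0 + d) _ _.
- lra.
- apply/continuous_in_subspaceT => t; rewrite inE /= => tI.
  have [du dv _ _] : [/\ differentiable u t, differentiable v t,
     `|'D_1 u t| <= C * (`|u t| + `|v t|) & `|'D_1 v t| <= C * (`|u t| + `|v t|)].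
    by apply: Hd; rewrite -dE.
  apply: cvgD; apply: cvg_norm; exact: differentiable_continuous.
have m0 t : 0 <= m t by rewrite addr_ge0.
have um : `|u tm| <= C * m tm * d.
  rewrite -[u tm]subr0 -u0; apply: mean_value_rV_dist; first by rewrite -dE.
  move=> s sd; have [du _ uC _] := Hd s sd; split => //.
  by apply: le_trans uC _; apply: ler_wpM2l => //; apply: mmax; rewrite dE.
have vm : `|v tm| <= C * m tm * d.
  rewrite -[v tm]subr0 -v0; apply: mean_value_rV_dist; first by rewrite -dE.
  move=> s sd; have [_ dv _ vC] := Hd s sd; split => //.
  by apply: le_trans vC _; apply: ler_wpM2l => //; apply: mmax; rewrite dE.
have mm : m tm <= 0.
  have := m0 tm; move: (lerD um vm); rewrite -/(m tm); nra.
have : \forall t \near t0, ball t0 d t by exact: nbhsx_ballx.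
apply: filterS => t; rewrite /ball/= distrC => /ltW td.
have : m t <= 0 by apply: le_trans mm; apply: mmax; rewrite dE.
rewrite /m => mt; split; apply/eqP; rewrite -normr_le0.
  by apply: le_trans mt; rewrite lerDl.
by apply: le_trans mt; rewrite lerDr.
Qed.

Lemma near_bounded (T : topologicalType) W (f : T -> W) t : {for t, continuous f} ->
  exists2 C, 0 <= C & \forall s \near t, `|f s| <= C.
Proof.
move=> cf; exists (`|f t| + 1); first by rewrite addr_ge0.
have {}cf : f s @[s --> t] --> f t := cf.
move/cvgrPdist_lt : cf => /(_ 1 ltr01); apply: filterS => s /ltW h.
rewrite -[f s](subrKC (f t)) (le_trans (ler_normD _ _))// lerD2l.
by rewrite distrC.
Qed.

Section LipschitzPairs.
Variables (t0 : R) (m : R -> R).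
Hypothesis m_ge0 : forall t, 0 <= m t.

(** What a locally Lipschitz right-hand side gives along two solutions: the two
    evaluations a and b are bounded and differ by at most a multiple of the
    distance m between the solutions.  Speaking of pairs of functions of time,
    rather than of Lipschitz maps, puts the positions, the velocities and a
    time-dependent coefficient on the same footing, so that closure under sums
    and products covers every expression built from them. *)
Definition lipschitz_pair W (a b : R -> W) : Prop :=
  exists2 C, 0 <= C & \forall t \near t0,
    [/\ `|a t| <= C, `|b t| <= C & `|a t - b t| <= C * m t].

Lemma lipschitz_pairD W (a a' b b' : R -> W) :
  lipschitz_pair a b -> lipschitz_pair a' b' ->
  lipschitz_pair (fun t => a t + a' t) (fun t => b t + b' t).
Proof.
move=> [C C0 HC] [D D0 HD]; exists (C + D); first exact: addr_ge0.
apply: filterS2 HC HD => t [aC bC abC] [aD bD abD]; split.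
- by rewrite (le_trans (ler_normD _ _))// lerD.
- by rewrite (le_trans (ler_normD _ _))// lerD.
- by rewrite opprD addrACA (le_trans (ler_normD _ _))// mulrDl lerD.
Qed.

Lemma lipschitz_pairN W (a b : R -> W) :
  lipschitz_pair a b -> lipschitz_pair (fun t => - a t) (fun t => - b t).
Proof.
move=> [C C0 HC]; exists C => //; apply: filterS HC => t [? ? ?].
by rewrite !normrN -opprD normrN.
Qed.

Lemma lipschitz_pairZ W (k l : R -> R) (a b : R -> W) :
  lipschitz_pair k l -> lipschitz_pair a b ->
  lipschitz_pair (fun t => k t *: a t) (fun t => l t *: b t).
Proof.
move=> [C C0 HC] [D D0 HD]; exists (C * D + C * D); first by rewrite addr_ge0// mulr_ge0.
have CD0 : 0 <= C * D by rewrite mulr_ge0.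
apply: filterS2 HC HD => t [kC lC klC] [aD bD abD]; split.
- by rewrite normrZ (@le_trans _ _ (C * D)) ?lerDl// ler_pM.
- by rewrite normrZ (@le_trans _ _ (C * D)) ?lerDl// ler_pM.
- have -> : k t *: a t - l t *: b t = (k t - l t) *: a t + l t *: (a t - b t).
    by rewrite scalerBl scalerBr addrA subrK.
  rewrite (le_trans (ler_normD _ _))// !normrZ mulrDl lerD//.
    by rewrite mulrAC ler_pM.
  by rewrite -mulrA ler_pM.
Qed.

Lemma lipschitz_pair_cst W (w : W) : lipschitz_pair (fun=> w) (fun=> w).
Proof.
exists `|w| => //; apply: filterE => t; split => //.
by rewrite subrr normr0 mulr_ge0.
Qed.

Lemma lipschitz_pair_sum W n (a b : 'I_n -> R -> W) :
  (forall i, lipschitz_pair (a i) (b i)) ->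
  lipschitz_pair (fun t => \sum_(i < n) a i t) (fun t => \sum_(i < n) b i t).
Proof.
elim: n a b => [|n IH] a b ab.
  rewrite (_ : (fun t => \sum_(i < 0) a i t) = fun=> 0); last first.
    by apply/funext => t; rewrite big_ord0.
  rewrite (_ : (fun t => \sum_(i < 0) b i t) = fun=> 0); last first.
    by apply/funext => t; rewrite big_ord0.
  exact: lipschitz_pair_cst.
rewrite (_ : (fun t => \sum_(i < n.+1) a i t) =
    fun t => a ord0 t + \sum_(i < n) a (lift ord0 i) t); last first.
  by apply/funext => t; rewrite big_ord_recl.
rewrite (_ : (fun t => \sum_(i < n.+1) b i t) =
    fun t => b ord0 t + \sum_(i < n) b (lift ord0 i) t); last first.
  by apply/funext => t; rewrite big_ord_recl.
by apply: lipschitz_pairD => //; apply: IH.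
Qed.

Lemma near_eq_lipschitz_pair W (a a' b b' : R -> W) :
  (\forall t \near t0, a t = a' t) -> (\forall t \near t0, b t = b' t) ->
  lipschitz_pair a b -> lipschitz_pair a' b'.
Proof.
move=> ea eb [C C0 HC]; exists C => //.
by apply: filterS3 ea eb HC => t <- <-.
Qed.

Lemma lipschitz_pair_entry n (a b : R -> 'rV[R]_n) i :
  lipschitz_pair a b -> lipschitz_pair (fun t => a t 0 i) (fun t => b t 0 i).
Proof.
move=> [C C0 HC]; exists C => //; apply: filterS HC => t [aC bC abC]; split.
- exact: le_trans (rV_norm_entry _ _) aC.
- exact: le_trans (rV_norm_entry _ _) bC.
- have -> : a t 0 i - b t 0 i = (a t - b t) 0 i by rewrite !mxE.
  exact: le_trans (rV_norm_entry _ _) abC.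
Qed.

Lemma lipschitz_pair_continuous W (a b : R -> W) :
  {for t0, continuous a} -> {for t0, continuous b} ->
  (\forall t \near t0, `|a t - b t| <= m t) -> lipschitz_pair a b.
Proof.
move=> /near_bounded[C C0 aC] /near_bounded[D D0 bD] abm.
exists (Num.max 1 (Num.max C D)); first by rewrite le_max ler01.
apply: filterS3 aC bD abm => t aC bD abm; split.
- by rewrite !le_max aC !orbT.
- by rewrite !le_max bD !orbT.
- by apply: (le_trans abm); rewrite ler_peMl// le_max lexx.
Qed.

Lemma lipschitz_pair_refl W (a : R -> W) :
  {for t0, continuous a} -> lipschitz_pair a a.
Proof.
move=> ca; apply: lipschitz_pair_continuous => //.
by apply: filterE => t; rewrite subrr normr0.
Qed.

(** Expanding in the basis reduces this to sums and products; it is used for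
    L t = J (x t) and twice for the Christoffel symbols. *)
Lemma lipschitz_pair_linear W n (La Lb : R -> 'rV[R]_n -> W) (u v : R -> 'rV[R]_n) :
  (\forall t \near t0, forall k e e', La t (k *: e + e') = k *: La t e + La t e') ->
  (\forall t \near t0, forall k e e', Lb t (k *: e + e') = k *: Lb t e + Lb t e') ->
  (forall e, lipschitz_pair (La ^~ e) (Lb ^~ e)) -> lipschitz_pair u v ->
  lipschitz_pair (fun t => La t (u t)) (fun t => Lb t (v t)).
Proof.
move=> linA linB Lab uv.
apply: (@near_eq_lipschitz_pair _
  (fun t => \sum_(i < n) u t 0 i *: La t (delta_mx 0 i)) _
  (fun t => \sum_(i < n) v t 0 i *: Lb t (delta_mx 0 i))).
- by apply: filterS linA => t linAt; rewrite -linear_rV_sum.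
- by apply: filterS linB => t linBt; rewrite -linear_rV_sum.
apply: lipschitz_pair_sum => i; apply: lipschitz_pairZ => //.
exact: lipschitz_pair_entry.
Qed.

End LipschitzPairs.

(** The partial derivatives are bounded near p, hence so is the derivative of f
    along the segment from y to x, which stays in a ball around p. *)
Lemma C1_locally_lipschitz n k (U : set 'rV[R]_n) (f : 'rV[R]_n -> 'rV[R]_k) p :
  open U -> Ck_on 1 U f -> U p ->
  exists2 K, 0 <= K & exists2 e, 0 < e & forall x y, ball p e x -> ball p e y ->
    `|f x - f y| <= K * `|x - y|.
Proof.
move=> oU [df cf] Up.
have [K [K0 HK]] : exists K, 0 <= K /\ \forall x \near p,
    forall i : 'I_n, `|'D_(delta_mx 0 i) f x| <= K.
  have bd i : exists C, 0 <= C /\ \forall x \near p, `|'D_(delta_mx 0 i) f x| <= C.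
    have /near_bounded[C C0 H] : {for p, continuous (fun x => 'D_(delta_mx 0 i) f x)}.
      exact: cf.
    by exists C.
  exists (\sum_i sval (cid (bd i))); split.
    by apply: sumr_ge0 => i _; case: cid => C [].
  apply: (@filter_forall _ 'I_n (fun i x =>
      `|'D_(delta_mx 0 i) f x| <= \sum_i sval (cid (bd i))) (nbhs p) _) => i.
  have [_ bi] := svalP (cid (bd i)).
  apply: filterS bi => x /le_trans; apply.
  rewrite (bigD1 i)//= lerDl; apply: sumr_ge0 => j _.
  by case: cid => C [].
have : \forall x \near p, U x /\ forall i : 'I_n, `|'D_(delta_mx 0 i) f x| <= K.
  by apply: filterS2 HK (open_nbhs_nbhs (conj oU Up)) => x.
move=> /nbhs_ballP[e /= e0 He].
exists (\sum_(i < n) K); first by apply: sumr_ge0.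
exists e => // x y xe ye.
pose c (s : R) := y + s *: (x - y).
have cb s : 0 <= s <= 1 -> ball p e (c s).
  move=> /andP[s0 s1]; move: xe ye; rewrite -ball_normE /= => xe ye.
  have -> : p - c s = (1 - s) *: (p - y) + s *: (p - x).
    by rewrite /c; apply/matrixP => i j; rewrite !mxE; lra.
  rewrite (le_lt_trans (ler_normD _ _))// !normrZ !ger0_norm ?subr_ge0//.
  have [->|s_neq0] := eqVneq s 0; first by rewrite subr0 mul0r addr0 mul1r.
  have s_gt0 : 0 < s by rewrite lt_neqAle eq_sym s_neq0.
  nra.
have dc (s : R) : is_derive s 1 c (x - y).
  have dxy : differentiable (fun s : R => s *: (x - y)) s by exact: differentiableZl.
  apply: DeriveDef; first exact/diff_derivable/differentiableD.
  rewrite deriveD ?derive_cst ?add0r; first last.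
  - exact: diff_derivable.
  - exact: diff_derivable.
  by rewrite derive_scale// derive_cst derive_id scaler0 add0r scale1r.
have := @mean_value_rV k (f \o c) 0 1 ((\sum_(i < n) K) * `|x - y|) ler01.
rewrite subr0 mulr1 /= /c scale1r scale0r addr0 subrKC; apply.
move=> s s01.
have dcs : differentiable c s by apply/derivable1_diffP; exact: ex_derive.
have [Uc Kc] := He _ (cb s s01).
split; first by apply: differentiable_comp => //; exact: df.
rewrite (derive_curve dcs (df _ Uc)) derive_val.
rewrite (linear_rV_sum (derive_linear (df _ Uc))).
apply: (le_trans (ler_norm_sum _ _ _)); rewrite mulr_suml.
apply: ler_sum => i _; rewrite normrZ mulrC ler_pM//.
exact: rV_norm_entry.
Qed.

Lemma lipschitz_pair_comp n k (U : set 'rV[R]_n) (f : 'rV[R]_n -> 'rV[R]_k)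
    t0 (m : R -> R) (x y : R -> 'rV[R]_n) :
  open U -> Ck_on 1 U f -> U (x t0) -> x t0 = y t0 ->
  {for t0, continuous x} -> {for t0, continuous y} ->
  (\forall t \near t0, `|x t - y t| <= m t) ->
  lipschitz_pair t0 m (f \o x) (f \o y).
Proof.
move=> oU fC1 Ux xy cx cy xym.
have [K K0 [e e0 HK]] := C1_locally_lipschitz oU fC1 Ux.
have cf : {for x t0, continuous f}.
  by apply: differentiable_continuous; apply: fC1.1.
have [C C0 xC] : exists2 C, 0 <= C & \forall t \near t0, `|f (x t)| <= C.
  by apply: near_bounded; exact: continuous_comp cx cf.
have [D D0 yD] : exists2 D, 0 <= D & \forall t \near t0, `|f (y t)| <= D.
  by rewrite xy in cf; apply: near_bounded; exact: continuous_comp cy cf.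
have xe : \forall t \near t0, ball (x t0) e (x t) by apply: cx; exact: nbhsx_ballx.
have ye : \forall t \near t0, ball (x t0) e (y t).
  by apply: cy; rewrite -xy; exact: nbhsx_ballx.
exists (K + C + D); first by rewrite !addr_ge0.
near=> t.
have m0 : 0 <= m t by apply: le_trans (normr_ge0 (x t - y t)) _; near: t.
split.
- apply: (@le_trans _ _ C); first by near: t.
  lra.
- apply: (@le_trans _ _ D); first by near: t.
  lra.
- apply: (@le_trans _ _ (K * `|x t - y t|)).
    by apply: HK; near: t.
  apply: ler_pM => //; first lra.
  by near: t.
Unshelve. all: by end_near. Qed.

End Estimates.

(** * Closure properties of smooth maps *)

Section SmoothClosure.
Context {R : realType} {V : normedModType R}.
Implicit Types W : normedModType R.
Variables (U : set V) (oU : open U).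

Lemma open_near_eq W (f g : V -> W) x : (forall y, U y -> f y = g y) -> U x ->
  \forall y \near x, f y = g y.
Proof. by move=> fg Ux; exact: filterS fg (open_nbhs_nbhs (conj oU Ux)). Qed.

Lemma eq_Ck_on W k (f g : V -> W) : (forall x, U x -> f x = g x) ->
  Ck_on k U f -> Ck_on k U g.
Proof.
elim: k f g => [|k IH] f g fg /=.
  move=> cf x Ux.
  have gx : f x = g x by exact: fg.
  have : g y @[y --> x] --> f x.
    apply: cvg_trans (cf x Ux).
    by apply: near_eq_cvg; exact: open_near_eq.
  by rewrite gx.
move=> [df cf]; split.
  move=> x Ux; apply: near_eq_differentiable (df x Ux).
  exact: open_near_eq.
move=> v; apply: IH (cf v) => x Ux.
by apply: near_eq_derive; exact: open_near_eq.
Qed.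

Lemma Ck_onW W k (f : V -> W) : Ck_on k.+1 U f -> Ck_on k U f.
Proof.
elim: k f => [|k IH] f /= [df cf]; last by split => // v; exact: IH.
by move=> x Ux; exact/differentiable_continuous/df.
Qed.

Lemma Ck_on_cst W k (w : W) : Ck_on k U (fun=> w).
Proof.
elim: k w => [|k IH] w /=; first by move=> x _; exact: cvg_cst.
by split => // v; apply: eq_Ck_on (IH 0) => x _; rewrite derive_cst.
Qed.

Lemma Ck_onD W k (f g : V -> W) : Ck_on k U f -> Ck_on k U g ->
  Ck_on k U (fun x => f x + g x).
Proof.
elim: k f g => [|k IH] f g /=.
  by move=> cf cg x Ux; apply: cvgD; [exact: cf|exact: cg].
move=> [df cf] [dg cg]; split.
  by move=> x Ux; exact: (differentiableD (df x Ux) (dg x Ux)).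
move=> v; apply: eq_Ck_on (IH _ _ (cf v) (cg v)) => x Ux.
by rewrite -deriveD//; apply: diff_derivable; [exact: df|exact: dg].
Qed.

Lemma Ck_onZ W k (a : V -> R) (f : V -> W) : Ck_on k U a -> Ck_on k U f ->
  Ck_on k U (fun x => a x *: f x).
Proof.
elim: k a f => [|k IH] a f.
  by move=> /= ca cf x Ux; apply: cvgZ; [exact: ca|exact: cf].
move=> ka kf; have [da ca] := ka; have [df cf] := kf.
split; first by move=> x Ux; exact: (differentiable_scale (da x Ux) (df x Ux)).
move=> v.
apply: eq_Ck_on (Ck_onD (IH _ _ (Ck_onW ka) (cf v)) (IH _ _ (ca v) (Ck_onW kf))).
by move=> x Ux; rewrite -derive_scale//; [exact: da|exact: df].
Qed.

Lemma smooth_differentiable W (f : V -> W) x : smooth_on U f -> U x -> differentiable f x.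
Proof. by move=> /(_ 1%N)[df _]; exact: df. Qed.

Lemma smooth_derive W (f : V -> W) v : smooth_on U f -> smooth_on U ('D_v f).
Proof. by move=> sf k; have [_] := sf k.+1; exact. Qed.

Lemma smooth_continuous W (f : V -> W) x : smooth_on U f -> U x -> {for x, continuous f}.
Proof. by move=> /(_ 0%N); exact. Qed.

End SmoothClosure.

(** * Linear algebra of a contact structure at a point *)

Section PointwiseGeometry.
Context {R : realType} (S : contact_subriemannian3 R).
Variables (X0 : vector_field S) (J : endo_field S) (nabla : connection S).
Hypotheses (hX0 : is_reeb X0) (hJ : is_contact_endo X0 J)
  (hnabla : is_tanno_connection X0 J nabla).

Local Notation w := (csr_form S).
Local Notation g := (csr_metric S).
Local Notation G := (ext_metric X0).

Implicit Types (c : atlas S) (x u v a : 'rV[R]_3).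

Lemma form0 c x : img c x -> w c x 0 = 0.
Proof.
move=> cx; have := form_linear w (-1) 0 0 cx.
by rewrite scaleN1r oppr0 addr0 mulN1r addNr.
Qed.

Lemma formB c x u v : img c x -> w c x (u - v) = w c x u - w c x v.
Proof.
by move=> cx; rewrite addrC -scaleN1r form_linear// mulN1r addrC.
Qed.

Lemma formZ c x (k : R) u : img c x -> w c x (k *: u) = k * w c x u.
Proof.
by move=> cx; rewrite -[k *: u]addr0 form_linear// form0// addr0.
Qed.

Definition horizontal_part c x u := u - w c x u *: X0 c x.

Lemma horizontal_part_horizontal c x u : img c x -> w c x (horizontal_part c x u) = 0.
Proof.
move=> cx; rewrite formB// formZ//.
by have [-> _] := hX0 cx; rewrite mulr1 subrr.
Qed.

Lemma horizontal_part_linear c x (k : R) u v : img c x ->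
  horizontal_part c x (k *: u + v) = k *: horizontal_part c x u + horizontal_part c x v.
Proof.
move=> cx; rewrite /horizontal_part form_linear// scalerDl scalerBr -scalerA opprD.
by rewrite addrACA.
Qed.

Lemma ext_metricC c x u v : img c x -> G c x u v = G c x v u.
Proof.
move=> cx; rewrite /ext_metric mulrC; congr (_ + _).
by apply: Defs.metric_sym => //; exact: horizontal_part_horizontal.
Qed.

Lemma ext_metric_linearl c x v : img c x -> forall (k : R) u u',
  G c x (k *: u + u') v = k *: G c x u v + G c x u' v.
Proof.
move=> cx k u u'; rewrite /ext_metric -!/(horizontal_part c x _) horizontal_part_linear//.
rewrite metric_linear ?form_linear//; try exact: horizontal_part_horizontal.
by rewrite -/(k * _) scalerDr mulrDl addrACA /GRing.scale/= mulrA.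
Qed.

Lemma ext_metric_linearr c x u : img c x -> forall (k : R) v v',
  G c x u (k *: v + v') = k *: G c x u v + G c x u v'.
Proof.
move=> cx k v v'; rewrite !(ext_metricC u)//.
exact: ext_metric_linearl.
Qed.

Lemma ext_metric_horizontal c x u v : w c x u = 0 -> w c x v = 0 ->
  G c x u v = g c x u v.
Proof. by move=> u0 v0; rewrite /ext_metric u0 v0 !scale0r !subr0 mulr0 addr0. Qed.

Lemma horizontal_part_smooth c u : smooth_on (img c) (fun x => horizontal_part c x u).
Proof.
have oc := @img_open _ _ (chart_of c).
move=> k; apply: (@eq_Ck_on _ _ _ oc _ _ (fun x => u + (- w c x u) *: X0 c x)).
  by move=> x _; rewrite scaleNr.
apply: Ck_onD => //; first exact: Ck_on_cst.
apply: Ck_onZ => //; last exact: vf_smooth.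
apply: (@eq_Ck_on _ _ _ oc _ _ (fun x => (-1) *: w c x u)).
  by move=> x _; rewrite scaleN1r.
apply: Ck_onZ => //; first exact: Ck_on_cst.
exact: form_smooth.
Qed.

(** The metric is only known to be smooth on horizontal fields; the horizontal
    parts of constant fields are such fields. *)
Lemma ext_metric_smooth c u v : smooth_on (img c) (fun x => G c x u v).
Proof.
have oc := @img_open _ _ (chart_of c).
move=> k; apply: Ck_onD => //; last first.
  by apply: (Ck_onZ oc); exact: form_smooth.
apply: metric_smooth; split; try exact: horizontal_part_smooth.
  by move=> x cx; exact: horizontal_part_horizontal.
by move=> x cx; exact: horizontal_part_horizontal.
Qed.

Lemma smooth_cst c u : local_vf c (fun=> u).
Proof. by move=> k; apply: Ck_on_cst; exact: img_open. Qed.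

(** The condition nabla w = 0 on constant fields, whose covariant derivative is
    given by the Christoffel symbols alone; likewise for the metric below. *)
Lemma form_parallel c x u v : img c x ->
  'D_u (fun y => w c y v) x = w c x (christoffel nabla c x u v).
Proof.
move=> cx; have [H _ _ _ _] := hnabla c.
have := H _ _ (smooth_cst c u) (smooth_cst c v) x cx.
by rewrite /cov_deriv derive_cst add0r => /eqP; rewrite subr_eq0 => /eqP.
Qed.

Lemma ext_metric_parallel c x u v v' : img c x ->
  'D_u (fun y => G c y v v') x =
  G c x (christoffel nabla c x u v) v' + G c x v (christoffel nabla c x u v').
Proof.
move=> cx; have [_ _ H _ _] := hnabla c.
have := H _ _ _ (smooth_cst c u) (smooth_cst c v) (smooth_cst c v') x cx.
rewrite /cov_deriv !derive_cst !add0r => /eqP.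
by rewrite -addrA -opprD subr_eq0 => /eqP.
Qed.

Lemma metric0l c x u : img c x -> w c x u = 0 -> g c x 0 u = 0.
Proof.
move=> cx u0; have := metric_linear g (-1) cx (form0 cx) (form0 cx) u0.
by rewrite scaleN1r oppr0 addr0 mulN1r addNr.
Qed.

Lemma metricZl c x (k : R) u v : img c x -> w c x u = 0 -> w c x v = 0 ->
  g c x (k *: u) v = k * g c x u v.
Proof.
move=> cx u0 v0; have := metric_linear g k cx u0 (form0 cx) v0.
by rewrite metric0l// !addr0.
Qed.

(** The distribution has rank two, seen through the area form: if a is nonzero,
    then a / |a| and v are orthonormal, hence |vol(a / |a|, v)| = 1, and up to
    sign vol(a, v) is dw(a, v) = g(a, J v). *)
Lemma metric_J_sqr c x v a : img c x -> w c x v = 0 -> w c x a = 0 ->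
  g c x v v = 1 -> g c x a v = 0 -> g c x a a = (g c x a (J c x v)) ^+ 2.
Proof.
move=> cx v0 a0 vv av.
have [Jh Jg _] := hJ cx.
have [_ _ vol1] := csr_vol_area cx.
have [->|an0] := eqVneq a 0.
  by rewrite !metric0l ?form0// ?expr0n//; exact: Jh.
have aa : 0 < g c x a a by exact: metric_pos.
pose s := Num.sqrt (g c x a a).
have s0 : 0 < s by rewrite sqrtr_gt0.
have ss : s ^+ 2 = g c x a a by rewrite sqr_sqrtr// ltW.
have sa0 : w c x (s^-1 *: a) = 0 by rewrite formZ// a0 mulr0.
have : `|csr_vol c x (s^-1 *: a) v| = 1.
  apply: vol1 => //; last by rewrite metricZl// av mulr0.
  by rewrite metricZl// Defs.metric_sym// metricZl// -ss expr2 mulKf ?mulVf// gt_eqF.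
have volE : csr_vol c x (s^-1 *: a) v = - g c x (s^-1 *: a) (J c x v).
  by rewrite Jg// csr_normalized// opprK.
rewrite volE normrN metricZl//; last exact: Jh.
move=> h; rewrite -ss -[RHS]real_normK ?num_real//.
congr (_ ^+ 2); move: h; rewrite normrM normfV (gtr0_norm s0) => /(congr1 ( *%R s)).
by rewrite mulr1 mulVKf ?gt_eqF.
Qed.

(** By metric_J_sqr, P = g(J v, J v) satisfies P = P ^ 2, and the difference
    z = a - g(a, J v) J v satisfies g(z, z) = g(z, J v) ^ 2
    = (g(a, J v) (1 - P)) ^ 2.  This vanishes both for P = 1 and for J v = 0. *)
Lemma horizontal_orthogonal_decomp c x v a : img c x -> w c x v = 0 -> w c x a = 0 ->
  g c x v v = 1 -> g c x a v = 0 -> a = g c x a (J c x v) *: J c x v.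
Proof.
move=> cx v0 a0 vv av.
have [Jh Jg _] := hJ cx.
have Jv0 : w c x (J c x v) = 0 by exact: Jh.
have Jvv : g c x (J c x v) v = 0.
  have [_ vol_skew _] := csr_vol_area cx.
  rewrite Defs.metric_sym// Jg// csr_normalized//.
  have := vol_skew v v v0 v0; lra.
set h := g c x a (J c x v).
pose z := - h *: J c x v + a.
have z0 : w c x z = 0 by rewrite form_linear// Jv0 a0 mulr0 addr0.
have gzE u : w c x u = 0 -> g c x z u = - h * g c x (J c x v) u + g c x a u.
  by move=> hu; rewrite (metric_linear g).
have zv : g c x z v = 0 by rewrite gzE// Jvv av mulr0 addr0.
have zz := metric_J_sqr cx v0 z0 vv zv.
have JJ := metric_J_sqr cx v0 Jv0 vv Jvv.
suff : z == 0 by rewrite /z addrC scaleNr subr_eq0 => /eqP.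
apply/negPn/negP => zn0.
have := metric_pos g cx z0 zn0.
rewrite zz gzE// -/h.
have [Jn0|Jn0] := eqVneq (J c x v) 0.
  suff -> : h = 0 by rewrite oppr0 mul0r addr0 expr0n ltxx.
  by rewrite /h Jn0 Defs.metric_sym ?metric0l//; exact: form0.
have -> : g c x (J c x v) (J c x v) = 1.
  apply: (mulfI (lt0r_neq0 (metric_pos g cx Jv0 Jn0))).
  by rewrite mulr1 -expr2 -JJ.
by rewrite mulr1 addNr expr0n ltxx.
Qed.

End PointwiseGeometry.

(** * The equation satisfied by a curve in a chart *)

Section Curves.
Context {R : realType} (S : contact_subriemannian3 R).
Variables (X0 : vector_field S) (J : endo_field S) (nabla : connection S).
Hypotheses (hX0 : is_reeb X0) (hJ : is_contact_endo X0 J)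
  (hnabla : is_tanno_connection X0 J nabla).

Local Notation w := (csr_form S).
Local Notation g := (csr_metric S).
Local Notation G := (ext_metric X0).

Implicit Types (c d : atlas S) (x u v a : 'rV[R]_3).

Lemma transition_differentiable c d x : overlap c d x -> differentiable (transition c d) x.
Proof. by move=> cdx; have [dt _] := transition_smooth c d 1; exact: dt. Qed.

Lemma transition_derive_differentiable c d x u : overlap c d x ->
  differentiable (fun y => 'D_u (transition c d) y) x.
Proof. by move=> cdx; have [_ /(_ u)[dt _]] := transition_smooth c d 2; exact: dt. Qed.

(** The Reeb field is globally defined, so horizontal parts, and with them the
    extended metric, do not depend on the chart. *)
Lemma ext_metric_change c d x u v : overlap c d x ->
  G d (transition c d x) ('D_u (transition c d) x) ('D_v (transition c d) x) = G c x u v.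
Proof.
move=> cdx; have cx := cdx.1.
have projE a : 'D_a (transition c d) x - w c x a *: X0 d (transition c d x)
    = 'D_(horizontal_part X0 c x a) (transition c d) x.
  rewrite vf_change// /horizontal_part addrC -scaleNr.
  by rewrite -derive_linear ?scaleNr 1?addrC//; exact: transition_differentiable.
have := metric_change g cdx (horizontal_part_horizontal hX0 u cx)
  (horizontal_part_horizontal hX0 v cx).
rewrite /ext_metric -(projE u) -(projE v).
move: (form_change w u cdx) (form_change w v cdx).
move: ('D_u (transition c d) x) ('D_v (transition c d) x) => Du Dv.
by move=> -> -> ->.
Qed.

Section OneCurve.
Variables (I : set R) (z : R -> S).
Hypotheses (oI : open I) (sz : smooth_curve I z).

(** The curve is read in a fixed chart c here, whereas local_curve uses the chart
    selected at each time; a differential equation needs the former. *)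
Definition coord_curve c : R -> 'rV[R]_3 := fun t => Defs.coord c (z t).
Definition coord_velocity c : R -> 'rV[R]_3 := fun t => 'D_1 (coord_curve c) t.
Definition coord_acceleration c t : 'rV[R]_3 :=
  'D_1 (coord_velocity c) t
  + christoffel nabla c (coord_curve c t) (coord_velocity c t) (coord_velocity c t).
Definition curve_dom c : set R := I `&` z @^-1` dom c.

Lemma open_curve_dom c : open (curve_dom c).
Proof.
rewrite openE => t [It ct]; apply: filterI; first exact: open_nbhs_nbhs.
apply: (sz.1 t It); apply: open_nbhs_nbhs; split => //; exact: dom_open.
Qed.

Lemma near_curve_dom c t : curve_dom c t -> \forall s \near t, curve_dom c s.
Proof. by move=> ct; apply: open_nbhs_nbhs; split => //; exact: open_curve_dom. Qed.

Lemma coord_curve_img c t : curve_dom c t -> img c (coord_curve c t).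
Proof. by move=> [_ ct]; exact: Defs.coord_img. Qed.

Lemma near_coord_curve_img c t : curve_dom c t ->
  \forall s \near t, img c (coord_curve c s).
Proof. by move=> /near_curve_dom; apply: filterS; exact: coord_curve_img. Qed.

Lemma coord_curve_smooth c : smooth_on (curve_dom c) (coord_curve c).
Proof. exact: sz.2. Qed.

Lemma coord_velocity_smooth c : smooth_on (curve_dom c) (coord_velocity c).
Proof. by apply: smooth_derive; exact: coord_curve_smooth. Qed.

Lemma coord_curve_differentiable c t : curve_dom c t -> differentiable (coord_curve c) t.
Proof. by move=> ct; exact: smooth_differentiable (coord_curve_smooth c) ct. Qed.

Lemma coord_velocity_differentiable c t : curve_dom c t ->
  differentiable (coord_velocity c) t.
Proof. by move=> ct; exact: smooth_differentiable (coord_velocity_smooth c) ct. Qed.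

Lemma derive_along_curve (W : normedModType R) c (f : 'rV[R]_3 -> W) t : curve_dom c t ->
  differentiable f (coord_curve c t) ->
  'D_1 (fun s => f (coord_curve c s)) t = 'D_(coord_velocity c t) f (coord_curve c t).
Proof. by move=> ct df; apply: derive_curve => //; exact: coord_curve_differentiable. Qed.

Lemma differentiable_along_curve (W : normedModType R) c (f : 'rV[R]_3 -> W) t :
  curve_dom c t ->
  differentiable f (coord_curve c t) ->
  differentiable (fun s => f (coord_curve c s)) t.
Proof.
move=> ct df; apply: (differentiable_comp (coord_curve_differentiable ct)).
exact: df.
Qed.

Lemma curve_overlap c d t : curve_dom c t -> curve_dom d t -> overlap c d (coord_curve c t).
Proof.
move=> ct dt; split; first exact: coord_curve_img.
by rewrite /coord_curve Defs.coordK; [exact: dt.2|exact: ct.2].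
Qed.

Lemma coord_curve_change c d t : curve_dom c t ->
  transition c d (coord_curve c t) = coord_curve d t.
Proof. by move=> ct; rewrite /transition /coord_curve Defs.coordK//; exact: ct.2. Qed.

Lemma coord_velocity_change c d t : curve_dom c t -> curve_dom d t ->
  'D_(coord_velocity c t) (transition c d) (coord_curve c t) = coord_velocity d t.
Proof.
move=> ct dt.
rewrite -(derive_along_curve ct (transition_differentiable (curve_overlap ct dt))).
apply: near_eq_derive.
by apply: filterS (near_curve_dom ct) => s cs; exact: coord_curve_change.
Qed.

(** Differentiating y' = (D tau) x' produces the second derivative of the
    transition map tau, which is exactly what the transformation law of the
    Christoffel symbols compensates. *)
Lemma coord_acceleration_change c d t : curve_dom c t -> curve_dom d t ->
  'D_(coord_acceleration c t) (transition c d) (coord_curve c t) = coord_acceleration d t.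
Proof.
move=> ct dt; have cdt := curve_overlap ct dt.
have dvelE : 'D_1 (coord_velocity d) t =
   'D_(coord_velocity c t) (fun y => 'D_(coord_velocity c t) (transition c d) y)
     (coord_curve c t)
   + 'D_('D_1 (coord_velocity c) t) (transition c d) (coord_curve c t).
  rewrite -derive_along_curve//; last exact: transition_derive_differentiable.
  have <- := @derive_linear_family R R _ 3
    (fun s u => 'D_u (transition c d) (coord_curve c s)) (coord_velocity c) t 1.
  - apply: near_eq_derive.
    apply: filterS2 (near_curve_dom ct) (near_curve_dom dt) => s cs ds.
    by rewrite coord_velocity_change.
  - apply: filterS2 (near_curve_dom ct) (near_curve_dom dt) => s cs ds.
    exact/derive_linear/transition_differentiable/curve_overlap.
  - move=> v.
    apply: (@differentiable_along_curve _ c (fun y => 'D_v (transition c d) y)) => //.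
    exact: transition_derive_differentiable.
  - exact: coord_velocity_differentiable.
rewrite /coord_acceleration dvelE.
rewrite -(coord_curve_change d ct) -(coord_velocity_change ct dt).
have dt1 := transition_differentiable cdt.
rewrite (derive_dirD _ _ dt1) -(christoffel_change nabla _ _ cdt).
exact: etrans (addrCA _ _ _) (addrA _ _ _).
Qed.

Lemma curve_dom_chart_at t : I t -> curve_dom (chart_at (z t)) t.
Proof. by move=> It; split => //; exact: chart_at_dom. Qed.

Lemma velocityE t : velocity z t = coord_velocity (chart_at (z t)) t.
Proof. by rewrite /velocity derive1E. Qed.

Lemma cov_accelerationE t :
  cov_acceleration z nabla t = coord_acceleration (chart_at (z t)) t.
Proof.
rewrite /cov_acceleration velocityE derive1E.
have -> : derive1 (local_curve z t) = coord_velocity (chart_at (z t)).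
  by apply/funext => s; rewrite derive1E.
by [].
Qed.

Lemma char_deviation_chart c t : curve_dom c t ->
  char_deviation z X0 J nabla t =
  G c (coord_curve c t) (coord_acceleration c t)
    (J c (coord_curve c t) (coord_velocity c t)).
Proof.
move=> ct; have dt := curve_dom_chart_at ct.1.
rewrite /char_deviation cov_accelerationE velocityE.
have cdt := curve_overlap dt ct.
rewrite -(coord_velocity_change dt ct) -(coord_acceleration_change dt ct).
by rewrite -(coord_curve_change c dt) endo_change// ext_metric_change.
Qed.

Hypotheses (hz : horizontal I z) (az : arc_length_param I z).

Lemma coord_velocity_horizontal c t : curve_dom c t ->
  w c (coord_curve c t) (coord_velocity c t) = 0.
Proof.
move=> ct; have dt := curve_dom_chart_at ct.1.
rewrite -(coord_velocity_change dt ct) -(coord_curve_change c dt).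
rewrite form_change; last exact: curve_overlap.
by have := hz ct.1; rewrite velocityE.
Qed.

Lemma coord_velocity_unit c t : curve_dom c t ->
  g c (coord_curve c t) (coord_velocity c t) (coord_velocity c t) = 1.
Proof.
move=> ct; have dt := curve_dom_chart_at ct.1.
have hd := coord_velocity_horizontal dt.
rewrite -(coord_velocity_change dt ct) -(coord_curve_change c dt).
rewrite metric_change//; last exact: curve_overlap.
have := az ct.1; rewrite velocityE /local_curve -/(coord_curve _ t) => s1.
have : 0 <= g (chart_at (z t)) (coord_curve (chart_at (z t)) t)
  (coord_velocity (chart_at (z t)) t) (coord_velocity (chart_at (z t)) t).
  rewrite leNgt; apply/negP => /ltW /ler0_sqrtr s0.
  by move: s1; rewrite s0 => /eqP; rewrite eq_sym oner_eq0.
by move/sqr_sqrtr <-; rewrite s1 expr1n.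
Qed.

(** Differentiate w(x') = 0 along the curve, with w parallel. *)
Lemma form_coord_acceleration c t : curve_dom c t ->
  w c (coord_curve c t) (coord_acceleration c t) = 0.
Proof.
move=> ct; have ci := coord_curve_img ct.
rewrite /coord_acceleration addrC -[X in X + _]scale1r form_linear// mul1r.
rewrite -(form_parallel hnabla)// -derive_along_curve//; last first.
  exact: smooth_differentiable (form_smooth _ _ _) ci.
have <- := @derive_linear_family R R _ 3
    (fun s u => w c (coord_curve c s) u) (coord_velocity c) t 1.
- transitivity ('D_1 (fun=> 0 : R) t); last exact: derive_cst.
  apply: near_eq_derive.
  by apply: filterS (near_curve_dom ct) => s; exact: coord_velocity_horizontal.
- by apply: filterS (near_coord_curve_img ct) => s cs k u v; exact: form_linear.
- move=> v; apply: (@differentiable_along_curve _ c (fun y => w c y v)) => //.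
  exact: smooth_differentiable (form_smooth _ _ _) ci.
- exact: coord_velocity_differentiable.
Qed.

Lemma ext_metric_along_differentiable c (u v : R -> 'rV[R]_3) t : curve_dom c t ->
  differentiable u t -> differentiable v t ->
  differentiable (fun s => G c (coord_curve c s) (u s) (v s)) t.
Proof.
move=> ct du dv; have ci := coord_curve_img ct.
apply: (linear_family_differentiable (L := fun s a => G c (coord_curve c s) a (v s))) => //.
  by apply: filterS (near_coord_curve_img ct) => s cs; exact: ext_metric_linearl.
move=> a.
apply: (linear_family_differentiable (L := fun s b => G c (coord_curve c s) a b)) => //.
  by apply: filterS (near_coord_curve_img ct) => s cs; exact: ext_metric_linearr.
move=> b; apply: (@differentiable_along_curve _ c (fun y => G c y a b)) => //.
exact: smooth_differentiable (ext_metric_smooth hX0 _ _ _) ci.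
Qed.

(** Metric compatibility along a curve, deduced from its version for constant
    fields by the product rule in each of the two vector arguments. *)
Lemma derive_ext_metric_along c (u v : R -> 'rV[R]_3) t : curve_dom c t ->
  differentiable u t -> differentiable v t ->
  'D_1 (fun s => G c (coord_curve c s) (u s) (v s)) t =
  G c (coord_curve c t)
    ('D_1 u t
     + christoffel nabla c (coord_curve c t) (coord_velocity c t) (u t)) (v t)
  + G c (coord_curve c t) (u t)
    ('D_1 v t
     + christoffel nabla c (coord_curve c t) (coord_velocity c t) (v t)).
Proof.
move=> ct du dv; have ci := coord_curve_img ct.
have dG a b : differentiable (fun s => G c (coord_curve c s) a b) t.
  by apply: ext_metric_along_differentiable.
rewrite (@derive_linear_family R R _ 3
  (fun s a => G c (coord_curve c s) a (v s)))//; last 2 first.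
- by apply: filterS (near_coord_curve_img ct) => s cs; exact: ext_metric_linearl.
- by move=> a; apply: ext_metric_along_differentiable.
rewrite (@derive_linear_family R R _ 3
  (fun s b => G c (coord_curve c s) (u t) b))//; last first.
  by apply: filterS (near_coord_curve_img ct) => s cs; exact: ext_metric_linearr.
rewrite (@derive_along_curve _ c (fun y => G c y (u t) (v t)))//; last first.
  exact: smooth_differentiable (ext_metric_smooth hX0 _ _ _) ci.
rewrite (ext_metric_parallel hnabla)//.
rewrite -['D_1 u t]scale1r -['D_1 v t]scale1r ext_metric_linearl// ext_metric_linearr//.
rewrite !scale1r; ring.
Qed.

(** The acceleration is horizontal, and orthogonal to the velocity because the
    latter has constant norm; so it is a multiple of J x', and the coefficient
    is the characteristic deviation by definition. *)
Lemma curve_equation c t : curve_dom c t ->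
  coord_acceleration c t =
  char_deviation z X0 J nabla t *: J c (coord_curve c t) (coord_velocity c t).
Proof.
move=> ct; have ci := coord_curve_img ct.
have v0 := coord_velocity_horizontal ct.
have a0 := form_coord_acceleration ct.
have [Jh _ _] := hJ ci.
rewrite (char_deviation_chart ct) ext_metric_horizontal//; last exact: Jh.
apply: (horizontal_orthogonal_decomp hJ) => //; first exact: coord_velocity_unit.
have dv := coord_velocity_differentiable ct.
have := derive_ext_metric_along ct dv dv.
have -> : 'D_1 (fun s =>
    G c (coord_curve c s) (coord_velocity c s) (coord_velocity c s)) t = 0.
  transitivity ('D_1 (fun=> 1 : R) t); last exact: derive_cst.
  apply: near_eq_derive; apply: filterS (near_curve_dom ct) => s cs.
  by rewrite ext_metric_horizontal ?coord_velocity_unit ?coord_velocity_horizontal.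
rewrite -/(coord_acceleration c t) [X in _ + X](ext_metricC hX0)//.
rewrite ext_metric_horizontal// => /esym/eqP.
by rewrite -mulr2n mulrn_eq0 /= => /eqP.
Qed.

(** Chart independence is essential: near t the deviation is given by one formula
    in a fixed chart, although the chart selected at z s may jump with s. *)
Lemma char_deviation_continuous t : I t ->
  {for t, continuous (char_deviation z X0 J nabla)}.
Proof.
move=> It; pose c := chart_at (z t).
have ct : curve_dom c t by exact: curve_dom_chart_at.
have ci := coord_curve_img ct.
apply: differentiable_continuous.
have dv := coord_velocity_differentiable ct.
apply: (@near_eq_differentiable _ _ _ (fun s =>
  G c (coord_curve c s) (coord_acceleration c s)
    (J c (coord_curve c s) (coord_velocity c s)))).
  by apply: filterS (near_curve_dom ct) => s cs; rewrite (char_deviation_chart cs).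
apply: ext_metric_along_differentiable => //.
- apply: differentiableD.
    exact: smooth_differentiable (smooth_derive _ (coord_velocity_smooth c)) ct.
  apply: (linear_family_differentiable
    (L := fun s a => christoffel nabla c (coord_curve c s) a (coord_velocity c s))) => //.
    by apply: filterS (near_coord_curve_img ct) => s cs *; exact: christoffel_linearl.
  move=> a; apply: (linear_family_differentiable
    (L := fun s b => christoffel nabla c (coord_curve c s) a b)) => //.
    by apply: filterS (near_coord_curve_img ct) => s cs *; exact: christoffel_linearr.
  move=> b.
  apply: (@differentiable_along_curve _ c (fun y => christoffel nabla c y a b)) => //.
  exact: smooth_differentiable (christoffel_smooth _ _ _ _) ci.
- apply: (linear_family_differentiable (L := fun s a => J c (coord_curve c s) a)) => //.
    by apply: filterS (near_coord_curve_img ct) => s cs *; exact: endo_linear.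
  move=> b; apply: (@differentiable_along_curve _ c (fun y => J c y b)) => //.
  exact: smooth_differentiable (endo_smooth _ _ _) ci.
Qed.

End OneCurve.
End Curves.

(** * Uniqueness *)

Section Uniqueness.
Context {R : realType} (S : contact_subriemannian3 R).
Variables (X0 : vector_field S) (J : endo_field S) (nabla : connection S).
Hypotheses (hX0 : is_reeb X0) (hJ : is_contact_endo X0 J)
  (hnabla : is_tanno_connection X0 J nabla).
Variables (I : set R) (z1 z2 : R -> S).
Hypotheses (oI : open I) (sz1 : smooth_curve I z1) (sz2 : smooth_curve I z2)
  (hz1 : horizontal I z1) (hz2 : horizontal I z2)
  (az1 : arc_length_param I z1) (az2 : arc_length_param I z2)
  (hdev : forall t, I t ->
    char_deviation z1 X0 J nabla t = char_deviation z2 X0 J nabla t).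

(** Local uniqueness for x'' = h J(x) x' - Gamma(x)(x', x').  With x1 - x2 and v1 - v2
    as unknowns, the right-hand sides form a Lipschitz pair for
    m = |x1 - x2| + |v1 - v2|, so the differential inequality applies. *)
Lemma near_curve_eq (c : atlas S) t0 : curve_dom I z1 c t0 -> z1 t0 = z2 t0 ->
  coord_velocity z1 c t0 = coord_velocity z2 c t0 ->
  \forall t \near t0, z1 t = z2 t.
Proof.
move=> ct1 z12 v12.
have ct2 : curve_dom I z2 c t0 by split; [exact: ct1.1|rewrite /= -z12; exact: ct1.2].
have oc := @img_open _ _ (chart_of c).
pose x1 := coord_curve z1 c; pose x2 := coord_curve z2 c.
pose v1 := coord_velocity z1 c; pose v2 := coord_velocity z2 c.
pose m t := `|x1 t - x2 t| + `|v1 t - v2 t|.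
have m0 t : 0 <= m t by rewrite addr_ge0.
have x12 : x1 t0 = x2 t0 by rewrite /x1 /x2 /coord_curve z12.
have near1 := near_curve_dom oI sz1 ct1; have near2 := near_curve_dom oI sz2 ct2.
have img1 := near_coord_curve_img oI sz1 ct1.
have img2 := near_coord_curve_img oI sz2 ct2.
have cx1 : {for t0, continuous x1}.
  exact: smooth_continuous (coord_curve_smooth sz1 c) ct1.
have cx2 : {for t0, continuous x2}.
  exact: smooth_continuous (coord_curve_smooth sz2 c) ct2.
have lv : lipschitz_pair t0 m v1 v2.
  apply: (lipschitz_pair_continuous m0).
  - exact: (smooth_continuous (coord_velocity_smooth sz1 c) ct1).
  - exact: (smooth_continuous (coord_velocity_smooth sz2 c) ct2).
  - by apply: filterE => t; rewrite lerDr.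
have lcomp (f : 'rV[R]_3 -> 'rV[R]_3) : smooth_on (img c) f ->
    lipschitz_pair t0 m (f \o x1) (f \o x2).
  move=> sf; apply: (lipschitz_pair_comp oc (sf 1%N)) => //.
    exact: (coord_curve_img ct1).
  by apply: filterE => t; rewrite lerDl.
have lJ : lipschitz_pair t0 m (fun t => J c (x1 t) (v1 t)) (fun t => J c (x2 t) (v2 t)).
  apply: (lipschitz_pair_linear m0
    (La := fun t => J c (x1 t)) (Lb := fun t => J c (x2 t))) => //.
  - by apply: filterS img1 => t ? *; exact: endo_linear.
  - by apply: filterS img2 => t ? *; exact: endo_linear.
  - by move=> e; apply: (lcomp (fun x => J c x e)); exact: endo_smooth.
have lGamma : lipschitz_pair t0 m (fun t => christoffel nabla c (x1 t) (v1 t) (v1 t))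
    (fun t => christoffel nabla c (x2 t) (v2 t) (v2 t)).
  apply: (lipschitz_pair_linear m0 (La := fun t a => christoffel nabla c (x1 t) a (v1 t))
      (Lb := fun t a => christoffel nabla c (x2 t) a (v2 t))) => //.
  - by apply: filterS img1 => t ? *; exact: christoffel_linearl.
  - by apply: filterS img2 => t ? *; exact: christoffel_linearl.
  move=> a; apply: (lipschitz_pair_linear m0 (La := fun t => christoffel nabla c (x1 t) a)
      (Lb := fun t => christoffel nabla c (x2 t) a)) => //.
  - by apply: filterS img1 => t ? *; exact: christoffel_linearr.
  - by apply: filterS img2 => t ? *; exact: christoffel_linearr.
  move=> e; apply: (lcomp (fun x => christoffel nabla c x a e)).
  exact: christoffel_smooth.
have lh : lipschitz_pair t0 m (char_deviation z1 X0 J nabla) (char_deviation z1 X0 J nabla).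
  apply: (lipschitz_pair_refl m0).
  exact: (char_deviation_continuous hX0 oI sz1 ct1.1).
have [C C0 HC] := lipschitz_pairD (lipschitz_pairZ lh lJ) (lipschitz_pairN lGamma).
have dv1 t : curve_dom I z1 c t -> 'D_1 v1 t =
    char_deviation z1 X0 J nabla t *: J c (x1 t) (v1 t)
    - christoffel nabla c (x1 t) (v1 t) (v1 t).
  by move=> ct; rewrite -(curve_equation hX0 hJ hnabla oI sz1 hz1 az1 ct) addrK.
have dv2 t : curve_dom I z2 c t -> 'D_1 v2 t =
    char_deviation z1 X0 J nabla t *: J c (x2 t) (v2 t)
    - christoffel nabla c (x2 t) (v2 t) (v2 t).
  move=> ct; rewrite hdev; last exact: ct.1.
  by rewrite -(curve_equation hX0 hJ hnabla oI sz2 hz2 az2 ct) addrK.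
have := @linear_differential_inequality R 3 (fun t => x1 t - x2 t) (fun t => v1 t - v2 t)
  t0 (C + 1) (addr_ge0 C0 ler01).
(* C + 1 also bounds (x1 - x2)' = v1 - v2, for which 1 suffices *)
have P : \forall t \near t0, [/\ differentiable (fun t => x1 t - x2 t) t,
    differentiable (fun t => v1 t - v2 t) t,
    `|'D_1 (fun t => x1 t - x2 t) t| <= (C + 1) * (`|x1 t - x2 t| + `|v1 t - v2 t|)
  & `|'D_1 (fun t => v1 t - v2 t) t| <= (C + 1) * (`|x1 t - x2 t| + `|v1 t - v2 t|)].
  apply: filterS3 near1 near2 HC => t c1 c2 [_ _ Ct].
  have dx1 := coord_curve_differentiable sz1 c1.
  have dx2 := coord_curve_differentiable sz2 c2.
  have ddv1 := coord_velocity_differentiable sz1 c1.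
  have ddv2 := coord_velocity_differentiable sz2 c2.
  split.
  - exact: differentiableB.
  - exact: differentiableB.
  - rewrite deriveB; [|exact: diff_derivable|exact: diff_derivable].
    rewrite -/(v1 t) -/(v2 t) -/(m t).
    have : `|v1 t - v2 t| <= m t by rewrite lerDr.
    have := m0 t; nra.
  - rewrite deriveB; [|exact: diff_derivable|exact: diff_derivable].
    rewrite dv1// dv2// -/(m t); apply: (le_trans Ct).
    by rewrite ler_wpM2r// lerDl.
move=> /(_ P); rewrite x12 (v12 : v1 t0 = v2 t0) !subrr => /(_ erefl erefl) H.
apply: filterS3 near1 near2 H => t [_ c1] [_ c2] [/eqP + _].
rewrite subr_eq0 => /eqP xt.
by rewrite -(Defs.coordK c1) -(Defs.coordK c2) -/(x1 t) -/(x2 t); congr (param c _).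
Qed.

End Uniqueness.

Lemma eq_on_closure (T U : topologicalType) (f g : T -> U) (A : set T) t :
  hausdorff_space U -> {for t, continuous f} -> {for t, continuous g} ->
  (forall s, A s -> f s = g s) -> closure A t -> f t = g t.
Proof.
move=> hU cf cg fg At; apply: hU => B D fB gD.
have nB : nbhs t (f @^-1` B) by exact: cf.
have nD : nbhs t (g @^-1` D) by exact: cg.
have [s [As [Bs Ds]]] := At _ (filterI nB nD).
by exists (f s); split => //; rewrite fg.
Qed.

Theorem proposition1 (R : realType) (S : contact_subriemannian3 R)
    (X0 : vector_field S) (J : endo_field S) (nabla : connection S)
    (hX0 : is_reeb X0) (hJ : is_contact_endo X0 J)
    (hnabla : is_tanno_connection X0 J nabla)
    (I : set R) (hIopen : open I) (hIint : is_interval I) (hI0 : I 0)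
    (zeta1 zeta2 : R -> S)
    (smooth1 : smooth_curve I zeta1) (smooth2 : smooth_curve I zeta2)
    (horiz1 : horizontal I zeta1) (horiz2 : horizontal I zeta2)
    (arc1 : arc_length_param I zeta1) (arc2 : arc_length_param I zeta2)
    (hpos : zeta1 0 = zeta2 0) (hvel : velocity zeta1 0 = velocity zeta2 0)
    (hdev : forall t, I t ->
      char_deviation zeta1 X0 J nabla t = char_deviation zeta2 X0 J nabla t) :
  forall t, I t -> zeta1 t = zeta2 t.
Proof.
(* Agreement near t, rather than at t: this makes E open at once, and gives
   equal velocities on E. *)
pose E : set R := fun t => (\forall s \near t, zeta1 s = zeta2 s).
have oE : open E by rewrite openE => t; exact: near_join.
have E0 : E 0.
  apply: (near_curve_eq hX0 hJ hnabla hIopen smooth1 smooth2 horiz1 horiz2 arc1 arc2 hdev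
    (curve_dom_chart_at zeta1 hI0)) => //.
  by move: hvel; rewrite !velocityE hpos.
have clE t : I t -> closure E t -> E t.
  move=> It Et.
  have z12 : zeta1 t = zeta2 t.
    apply: (eq_on_closure (@space_hausdorff _ S) (smooth1.1 t It) (smooth2.1 t It) _ Et).
    by move=> s; exact: nbhs_singleton.
  have c1 := curve_dom_chart_at zeta1 It.
  have c2 := curve_dom_chart_at zeta2 It; rewrite -z12 in c2.
  apply: (near_curve_eq hX0 hJ hnabla hIopen smooth1 smooth2 horiz1 horiz2 arc1 arc2
    hdev c1) => //.
  apply: (eq_on_closure (@norm_hausdorff _ _) _ _ _ Et).
  - exact: smooth_continuous (coord_velocity_smooth smooth1 _) c1.
  - exact: smooth_continuous (coord_velocity_smooth smooth2 _) c2.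
  - move=> s Es; apply: near_eq_derive.
    by apply: filterS Es => r; rewrite /coord_curve => ->.
have : connected I by exact/connected_intervalP.
move=> /(_ (I `&` E)) IE.
have {}IE : I `&` E = I.
  apply: IE.
  - by exists 0.
  - by exists E.
  - exists (closure E); first exact: closed_closure.
    rewrite predeqE => t; split=> -[It Et]; split => //.
      exact: subset_closure.
    exact: clE.
by move=> t; rewrite -IE => -[_ /nbhs_singleton].
Qed.
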